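(* Let $s>2$ be a prime power and $n\ge 2$. Take any column of $H(X_1,\dots,X_n)$ as a branching column. For $1\le k<s$, the row juxtaposition of any $k$ fractions forms an $SSD(ks^{n-1},s^m)$ with $m=(s^n-s)/(s-1)$ after removing the branching column. It has overall $A_2=(s^n-s)(s-k)/(2k)$ and is optimal under GMA. Furthermore, all possible projected $A_2$ values are $0$ and $(s-k)/k$. There are $(s^n-s)/2$ pairs of nonorthogonal columns with projected $A_2=(s-k)/k$. In particular, there are no fully aliased columns for $1<k<s$.
   Context: Designs: $SSD(N,s^m)$ denotes an $N\times m$ matrix $D=[x_{ik}]$ with entries in a set of $s$ symbols (here the finite field $F_s$ with $s$ elements), which is balanced: in every column each symbol appears exactly $N/s$ times. Generalized wordlength pattern: choose orthonormal contrasts on the symbol set, i.e. complex-valued functions $c_1,\dots,c_{s-1}$ on the symbols with $\sum_x c_a(x)=0$ and $\sum_x c_a(x)\overline{c_b(x)}=s$ if $a=b$ and $0$ otherwise. For $j=1,\dots,m$, $$A_j(D)=N^{-2}\sum_{K\subseteq\{1,\dots,m\},\,|K|=j}\ \sum_{(a_k)_{k\in K}\in\{1,\dots,s-1\}^K}\Big|\sum_{i=1}^N\prod_{k\in K}c_{a_k}(x_{ik})\Big|^2 ,$$ independently of the choice of contrasts. The overall $A_2$ is $A_2(D)$; the projected $A_2$ value of a pair of columns is $A_2$ of the two-column design they form. $D$ is optimal under GMA (generalized minimum aberration) if there is no $SSD(N,s^m)$ $D'$ and index $r$ with $A_j(D')=A_j(D)$ for all $j<r$ and $A_r(D')<A_r(D)$.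 Polynomial columns: a function $f(X_1,\dots,X_n)$ on $F_s^n$ gives a column of length $s^n$, rows being indexed by the points of $F_s^n$. $H(X_1,\dots,X_n)$ is the set of nonzero linear forms $c_1X_1+\cdots+c_nX_n$ ($c_i\in F_s$) whose last nonzero coefficient is $1$, regarded as the $s^n\times (s^n-1)/(s-1)$ design with these columns. Fractions: given a branching column, the $s^n$ rows are divided into $s$ fractions of $s^{n-1}$ rows each, according to the level of the branching column. The row juxtaposition of $k$ fractions consists of all rows whose level in the branching column lies in a given $k$-subset of $F_s$. Two columns of a design with $N$ runs are orthogonal if every one of the $s^2$ level combinations occurs equally often (projected $A_2=0$), and fully aliased if the pair has only $s$ distinct level combinations, each occurring $N/s$ times (projected $A_2=s-1$). *)

(* Defs.v *)
From mathcomp Require Import all_boot all_order all_algebra.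
Set Implicit Arguments.
Unset Strict Implicit.
Unset Printing Implicit Defensive.
Import GRing.Theory Num.Theory.
Local Open Scope ring_scope.

(* A design with N runs and m factors is a matrix D : 'M[F]_(N, m) whose
   entries are symbols of the finite field F; its number of levels is
   s = #|F|.  Exact quotients N / s are written multiplicatively. *)

Definition balanced (F : finFieldType) (N m : nat) (D : 'M[F]_(N, m)) : Prop :=
  forall (j : 'I_m) (x : F), (#|[set i : 'I_N | D i j == x]| * #|F| = N)%N.

(* D is an SSD(N, s^m).  The formal dimensions N', m' of D may be cardinals of
   sets rather than literal expressions, hence the two equations. *)
Definition is_SSD (F : finFieldType) (N m N' m' : nat) (D : 'M[F]_(N', m')) :
    Prop :=
  [/\ N' = N, m' = m & balanced D].

(* The complex numbers are represented by an arbitrary numClosedFieldType C,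
   e.g. algC, or R[i] for R : rcfType. *)
Definition orthonormal_contrasts (F : finFieldType) (C : numClosedFieldType)
    (c : 'I_(#|F|.-1) -> F -> C) : Prop :=
  (forall a, \sum_x c a x = 0) /\
  (forall a b, \sum_x c a x * (c b x)^* = if a == b then #|F|%:R else 0).

(* Generalized wordlength pattern; the inner sum runs over the families
   (a_k)_{k in K} of contrast indices.  The value does not depend on the choice
   of the orthonormal contrasts c. *)
Definition gwp (F : finFieldType) (C : numClosedFieldType)
    (c : 'I_(#|F|.-1) -> F -> C) (j N m : nat) (D : 'M[F]_(N, m)) : C :=
  N%:R ^- 2 *
  \sum_(K : {set 'I_m} | #|K| == j)
    \sum_(a : {ffun {k : 'I_m | k \in K} -> 'I_(#|F|.-1)})
      `|\sum_(i < N) \prod_(k : {k : 'I_m | k \in K}) c (a k) (D i (val k))| ^+ 2.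

Definition GMA_optimal (F : finFieldType) (C : numClosedFieldType)
    (c : 'I_(#|F|.-1) -> F -> C) (N m : nat) (D : 'M[F]_(N, m)) : Prop :=
  ~ exists (D' : 'M[F]_(N, m)) (r : nat),
      [/\ is_SSD N m D',
          (1 <= r <= m)%N,
          (forall j : nat, (1 <= j < r)%N -> gwp c j D' = gwp c j D)
        & gwp c r D' < gwp c r D].

Definition two_columns (F : finFieldType) (N m : nat) (D : 'M[F]_(N, m))
    (u v : 'I_m) : 'M[F]_(N, 2) :=
  colsub (fun l : 'I_2 => if l == 0 then u else v) D.

Definition projected_A2 (F : finFieldType) (C : numClosedFieldType)
    (c : 'I_(#|F|.-1) -> F -> C) (N m : nat) (D : 'M[F]_(N, m))
    (u v : 'I_m) : C :=
  gwp c 2 (two_columns D u v).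

Definition level_count (F : finFieldType) (N m : nat) (D : 'M[F]_(N, m))
    (u v : 'I_m) (z : F * F) : nat :=
  #|[set i : 'I_N | (D i u, D i v) == z]|.

Definition orthogonal_columns (F : finFieldType) (N m : nat)
    (D : 'M[F]_(N, m)) (u v : 'I_m) : bool :=
  [forall z, forall z', level_count D u v z == level_count D u v z'].

Definition fully_aliased (F : finFieldType) (N m : nat)
    (D : 'M[F]_(N, m)) (u v : 'I_m) : Prop :=
  #|[set z | level_count D u v z != 0%N]| = #|F| /\
  (forall z, level_count D u v z != 0%N ->
     (level_count D u v z * #|F| = N)%N).

(* A linear form c_1 X_1 + ... + c_n X_n is encoded by its coefficients. *)
Definition linear_form (F : finFieldType) (n : nat) (c x : 'rV[F]_n) : F :=
  \sum_(i < n) c 0 i * x 0 i.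

(* Linear forms whose last nonzero coefficient is 1 (hence nonzero). *)
Definition H_forms (F : finFieldType) (n : nat) : {set 'rV[F]_n} :=
  [set c : 'rV[F]_n |
    [exists i : 'I_n,
      (c 0 i == 1) && [forall j : 'I_n, (i < j)%N ==> (c 0 j == 0)]]].

Definition fraction_rows (F : finFieldType) (n : nat) (b : 'rV[F]_n)
    (S : {set F}) : {set 'rV[F]_n} :=
  [set x : 'rV[F]_n | linear_form b x \in S].

(* Row juxtaposition of the fractions with levels in S of the branching column
   b, the branching column being removed.  Runs and factors are listed in the
   order of the enumerations of the corresponding sets. *)
Definition juxtaposition (F : finFieldType) (n : nat) (b : 'rV[F]_n)
    (S : {set F}) : 'M[F]_(#|fraction_rows b S|, #|H_forms F n :\ b|) :=
  \matrix_(i, j) linear_form (enum_val j) (enum_val i).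

(* Main.v *)
Require Import Defs.
From mathcomp Require Import all_boot all_order all_algebra.
From mathcomp Require Import zify ring.
Set Implicit Arguments.
Unset Strict Implicit.
Unset Printing Implicit Defensive.
Import Order.TTheory GRing.Theory Num.Theory.
Local Open Scope ring_scope.

(** The wordlength pattern of a design depends only on how often its rows agree.
    By completeness of the contrasts, [\sum_a c_a(x) (c_a(y))^*] is
    [s [x = y] - 1] ([contrasts_kernel]), so [A_j] is the average over all pairs
    of rows of the [j]-th elementary symmetric function of [m] numbers, each
    [s - 1] or [-1] according to whether the rows agree in that column.
    Expanding it makes [A_j] a combination of the binomial moments
    [B_0, ..., B_j] of the number of coincidences, with leading coefficient
    [s ^ j > 0] ([gwp_coincidence_moment]). Hence minimizing the [A_j]
    sequentially amounts to minimizing the [B_j] sequentially. For balanced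
    designs of a given size [B_1] is fixed, and binomial coefficients are convex,
    so a balanced design whose distinct rows all agree in [q] or [q + 1] columns
    minimizes every [B_j] simultaneously ([coincidence_moment_min],
    [GMA_optimal_coincidences]).

    The juxtaposed fractions have this property. Two distinct rows [x] and [y]
    agree in the column of the form [h] when [h (x - y) = 0]; exactly
    [(s ^ (n - 1) - 1) / (s - 1)] elements of [H] satisfy this
    ([card_H_forms_root]), and the branching form, which is removed, is one of
    them or not.

    For the projected values, elements of [H] are regarded as the points of a
    projective space. If the forms [u], [v] and [b] are independent, all level
    combinations of the columns [u] and [v] occur equally often. Otherwise
    [b = x u + y v] with [x != 0], and a combination [z] occurs [s ^ (n - 2)]
    times when [x z_1 + y z_2] lies in [S] and never otherwise
    ([collinear_columnsP]). Since a projected [A_2] is determined by the level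
    counts ([projected_A2_level_count]), it equals [0] or [(s - k) / k].
    The line through [u] and [b] has [s - 1] further points, which gives
    [m (s - 1) / 2] nonorthogonal pairs, and the overall [A_2] is the sum of the
    projected ones ([gwp2_projected]). *)

(** * The wordlength pattern in terms of coincidences *)

Lemma mulmx1C_eqdim (R : comPzRingType) (p q : nat) (A : 'M[R]_(p, q))
    (B : 'M[R]_(q, p)) :
  p = q -> A *m B = 1%:M -> B *m A = 1%:M.
Proof. by move=> e; move: A B; rewrite e => A B; apply: mulmx1C. Qed.

(** Together with the constant function, the contrasts form a square matrix
    with orthogonal rows; its columns are then orthogonal as well. *)
Lemma contrasts_kernel (F : finFieldType) (C : numClosedFieldType)
    (c : 'I_(#|F|.-1) -> F -> C) :
  orthonormal_contrasts c ->
  forall x y, \sum_a c a x * (c a y)^* = #|F|%:R * (x == y)%:R - 1.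
Proof.
case=> c_sum0 c_orth x y.
have F_gt0 : (0 < #|F|)%N by apply/card_gt0P; exists 0.
have F_neq0 : #|F|%:R != 0 :> C by rewrite pnatr_eq0 -lt0n.
pose U : 'M[C]_(1 + #|F|.-1, #|F|) :=
  col_mx (const_mx 1) (\matrix_(a, j) c a (enum_val j)).
pose V : 'M[C]_(#|F|, 1 + #|F|.-1) :=
  #|F|%:R^-1 *: row_mx (const_mx 1) (\matrix_(j, a) (c a (enum_val j))^*).
have sumE (G : F -> C) : \sum_(j < #|F|) G (enum_val j) = \sum_z G z.
  rewrite [RHS](reindex (fun j : 'I_#|F| => enum_val j)) //=.
  exact/onW_bij/enum_val_bij.
have UV : U *m V = 1%:M.
  rewrite -scalemxAr mul_col_row (scalar_mx_block 1 #|F|.-1 1) scale_block_mx.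
  congr block_mx; apply/matrixP=> i j; rewrite !mxE.
  - under eq_bigr do rewrite !mxE mul1r.
    by rewrite sumr_const card_ord mulVf // !ord1.
  - under eq_bigr do rewrite !mxE mul1r.
    by rewrite (sumE (fun z => (c j z)^*)) -rmorph_sum /= c_sum0 conjC0 mulr0.
  - under eq_bigr do rewrite !mxE mulr1.
    by rewrite (sumE (c i)) c_sum0 mulr0.
  under eq_bigr do rewrite !mxE.
  rewrite (sumE (fun z => c i z * (c j z)^*)) c_orth.
  by case: eqP => _; rewrite ?mulr0 // mulVf.
have /matrixP/(_ (enum_rank y) (enum_rank x)) :=
  mulmx1C_eqdim (etrans (add1n _) (prednK F_gt0)) UV.
rewrite -scalemxAl mul_row_col !mxE big_ord1 !mxE mul1r.
under eq_bigr do rewrite !mxE !enum_rankK mulrC.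
rewrite (inj_eq enum_rank_inj) eq_sym => /(congr1 ( *%R #|F|%:R)).
by rewrite mulrA divff // mul1r => <-; rewrite [1 + _]addrC addrK.
Qed.

Lemma gwp_kernel (F : finFieldType) (C : numClosedFieldType)
    (c : 'I_(#|F|.-1) -> F -> C) (j N m : nat) (D : 'M[F]_(N, m)) :
  orthonormal_contrasts c ->
  gwp c j D = N%:R ^- 2 * \sum_i \sum_i' \sum_(K : {set 'I_m} | #|K| == j)
    \prod_(k in K) (#|F|%:R * (D i k == D i' k)%:R - 1).
Proof.
move=> hc; rewrite /gwp; congr (_ * _).
under [RHS]eq_bigr do rewrite exchange_big /=.
rewrite [RHS]exchange_big /=; apply: eq_bigr => K _.
transitivity (\sum_(a : {ffun {k : 'I_m | k \in K} -> 'I_(#|F|.-1)})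
  \sum_i \sum_i' \prod_(k : {k : 'I_m | k \in K})
     (c (a k) (D i (val k)) * (c (a k) (D i' (val k)))^*)).
  apply: eq_bigr => a _; rewrite normCK rmorph_sum /= mulr_suml.
  apply: eq_bigr => i _; rewrite mulr_sumr; apply: eq_bigr => i' _.
  by rewrite rmorph_prod /= big_split.
rewrite exchange_big /=; apply: eq_bigr => i _.
rewrite exchange_big /=; apply: eq_bigr => i' _.
rewrite (big_sub (mem K)) /= -(bigA_distr_bigA (fun (k : {k | k \in K}) a =>
  c a (D i (val k)) * (c a (D i' (val k)))^*)).
by apply: eq_bigr => k _; rewrite contrasts_kernel.
Qed.

(** The number of columns in which two rows agree. *)
Definition coincidences (F : finFieldType) (N m : nat) (D : 'M[F]_(N, m))
    (i i' : 'I_N) : nat :=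
  #|[set k : 'I_m | D i k == D i' k]|.

(** The binomial moments of the numbers of coincidences, over all ordered pairs
    of rows (a row being paired with itself too). *)
Definition coincidence_moment (F : finFieldType) (N m : nat)
    (D : 'M[F]_(N, m)) (t : nat) : nat :=
  \sum_i \sum_i' 'C(coincidences D i i', t).

(** The sets of cardinal [j] that contain [A]. *)
Lemma card_draws_sup (T : finType) (A : {set T}) (j : nat) :
  (#|A| <= j)%N ->
  #|[set K : {set T} | A \subset K & #|K| == j]| = 'C(#|T| - #|A|, j - #|A|).
Proof.
move=> le_Aj; rewrite -[in RHS](cardsC A) addKn -cards_draws.
have inj : {in [set B : {set T} | B \subset ~: A & #|B| == (j - #|A|)%N] &,
            injective (fun B => A :|: B)}.
  move=> B B'; rewrite !inE => /andP[sB _] /andP[sB' _].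
  move=> /(congr1 (fun X => X :&: ~: A)).
  by rewrite !setIUl setICr !set0U (setIidPl sB) (setIidPl sB').
rewrite -(card_in_imset inj); apply: eq_card => K; rewrite !inE.
apply/andP/imsetP => [[sAK /eqP cK]|[B]].
  exists (K :\: A); last by rewrite setDE setUIr setUCr setIT (setUidPr sAK).
  by rewrite !inE setDE subsetIr -setDE cardsDS // cK eqxx.
rewrite !inE => /andP[sB /eqP cB] ->; split; first exact: subsetUl.
rewrite cardsU cB; suff -> : A :&: B = set0 by rewrite cards0 subn0 subnKC.
by apply/eqP; rewrite setI_eq0 disjoint_sym disjoints_subset.
Qed.

(** The elementary symmetric functions of the entries [s [k in X] - 1], in
    terms of the cardinal of [X]. As functions of [#|T| - #|X|] they are the
    Krawtchouk polynomials. *)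
Lemma sum_prod_indicator (R : comPzRingType) (s : R) (T : finType)
    (X : {set T}) (j : nat) :
  \sum_(K : {set T} | #|K| == j) \prod_(k in K) (s * (k \in X)%:R - 1) =
  \sum_(t < j.+1)
    s ^+ t * (-1) ^+ (j - t) * 'C(#|T| - t, j - t)%:R * 'C(#|X|, t)%:R.
Proof.
pose w (A : {set T}) : R := s ^+ #|A| * (-1) ^+ (j - #|A|).
(* Expand each product over [K] as a sum over the subsets [A] of [K] where the
   term [s (k \in X)] is chosen; only [A \subset X] contributes. *)
transitivity (\sum_(K : {set T} | #|K| == j)
   \sum_(A : {set T} | A \subset X) (A \subset K)%:R * w A).
  apply: eq_bigr => K /eqP cK.
  rewrite big_mkcond /=.
  transitivity (\prod_k ((s * (k \in X :&: K)%:R) + (if k \in K then -1 else 1))).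
    apply: eq_bigr => k _; rewrite inE; case: (k \in K); rewrite ?andbT //.
    by rewrite andbF mulr0 add0r.
  rewrite bigA_distr [RHS]big_mkcond /=; apply: eq_bigr => A _.
  have [/subsetP sAX|nAX] := boolP (A \subset X); last first.
    have [k kA kX] := subsetPn nAX.
    by rewrite (bigD1 k) //= kA inE (negPf kX) mulr0 mul0r.
  have [/subsetP sAK|nAK] := boolP (A \subset K); last first.
    have [k kA kK] := subsetPn nAK.
    by rewrite (bigD1 k) //= kA inE (negPf kK) andbF mulr0 !mul0r.
  rewrite mul1r (bigID (mem A)) /=; congr (_ * _).
    rewrite (eq_bigr (fun=> s)) ?prodr_const //.
    by move=> k kA; rewrite kA inE sAX // sAK // mulr1.
  rewrite (eq_bigr (fun k => if k \in K then -1 else 1)); last first.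
    by move=> k /negPf ->.
  rewrite -big_mkcondr /= prodr_const -cK -cardsDS; last exact/subsetP.
  by congr (_ ^+ _); apply: eq_card => k; rewrite !inE.
rewrite exchange_big /=.
transitivity (\sum_(A : {set T} | A \subset X)
   (if (#|A| <= j)%N then w A * 'C(#|T| - #|A|, j - #|A|)%:R else 0)).
  apply: eq_bigr => A _; rewrite -mulr_suml mulrC.
  have -> : \sum_(K : {set T} | #|K| == j) (A \subset K)%:R =
      #|[set K : {set T} | A \subset K & #|K| == j]|%:R :> R.
    rewrite -natr_sum -sum1_card big_mkcond [in RHS]big_mkcond.
    congr (_%:R); apply: eq_bigr => K _; rewrite inE andbC.
    by case: (#|K| == j); case: (A \subset K).
  case: leqP => [le_Aj|lt_jA]; first by rewrite card_draws_sup.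
  rewrite (_ : [set _ | _ & _] = set0) ?cards0 ?mulr0 //.
  apply/setP => K; rewrite !inE; apply/negP => /andP[/subset_leq_card lAK].
  by move=> /eqP cK; rewrite cK leqNgt lt_jA in lAK.
rewrite -big_mkcondr /=.
rewrite (partition_big (fun A : {set T} => inord #|A| : 'I_j.+1) xpredT) //=.
apply: eq_bigr => t _.
rewrite (eq_bigl (fun A => A \in [set A : {set T} | A \subset X & #|A| == t])).
  rewrite (eq_bigr (fun=> s ^+ t * (-1) ^+ (j - t) * 'C(#|T| - t, j - t)%:R)).
    by rewrite sumr_const cards_draws [RHS]mulr_natr.
  by move=> A; rewrite inE /w => /andP[_ /eqP ->].
move=> A; rewrite inE -andbA; congr (_ && _).
apply/andP/eqP => [[le_Aj /eqP <-]|cA]; first by rewrite inordK.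
by rewrite cA -ltnS ltn_ord; split=> //; rewrite inord_val.
Qed.

Lemma gwp_coincidence_moment (F : finFieldType) (C : numClosedFieldType)
    (c : 'I_(#|F|.-1) -> F -> C) (j N m : nat) (D : 'M[F]_(N, m)) :
  orthonormal_contrasts c ->
  gwp c j D = N%:R ^- 2 * \sum_(t < j.+1)
    #|F|%:R ^+ t * (-1) ^+ (j - t) * 'C(m - t, j - t)%:R *
    (coincidence_moment D t)%:R.
Proof.
move=> hc; rewrite gwp_kernel //; congr (_ * _).
transitivity (\sum_i \sum_i' \sum_(t < j.+1)
    #|F|%:R ^+ t * (-1) ^+ (j - t) * 'C(m - t, j - t)%:R *
    'C(coincidences D i i', t)%:R : C).
  apply: eq_bigr => i _; apply: eq_bigr => i' _.
  have := sum_prod_indicator (#|F|%:R : C) [set k | D i k == D i' k] j.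
  rewrite card_ord => <-.
  by apply: eq_bigr => K _; apply: eq_bigr => k _; rewrite inE.
under eq_bigr do rewrite exchange_big /=.
rewrite exchange_big /=; apply: eq_bigr => t _.
rewrite natr_sum mulr_sumr; apply: eq_bigr => i _.
by rewrite natr_sum mulr_sumr.
Qed.

(** * Minimality of the coincidence moments *)

(** On the natural numbers, ['C(-, t.+1)] lies above its chord through [q] and
    [q.+1]. *)
Lemma binomial_chord (q d t : nat) :
  ('C(q, t.+1) + d * 'C(q, t) <= 'C(d, t.+1) + q * 'C(q, t))%N.
Proof.
case: (leqP q d) => [/subnKC <-|/ltnW /subnKC <-].
  elim: (d - q)%N => [|e IHe]; first by rewrite addn0.
  rewrite addnS binS mulSn.
  have := leq_bin2l t (leq_addr e q); lia.
move: (q - d)%N => e.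
suff: ('C(d + e, t.+1) <= 'C(d, t.+1) + e * 'C(d + e, t))%N by lia.
elim: e => [|e IHe]; first by rewrite addn0 leq_addr.
rewrite addnS binS.
have le_bin := leq_bin2l t (leqnSn (d + e)).
have := leq_mul (leqnn e) le_bin; rewrite mulSn; lia.
Qed.

Lemma coincidences_diag (F : finFieldType) (N m : nat) (D : 'M[F]_(N, m)) i :
  coincidences D i i = m.
Proof.
rewrite /coincidences -[RHS]card_ord; apply: eq_card => k.
by rewrite !inE eqxx.
Qed.

Lemma coincidence_moment_offdiag (F : finFieldType) (N m : nat)
    (D : 'M[F]_(N, m)) (t : nat) :
  coincidence_moment D t =
    (N * 'C(m, t) + \sum_i \sum_(i' | i' != i) 'C(coincidences D i i', t))%N.
Proof.
transitivity (\sum_i ('C(m, t) +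
    \sum_(i' | i' != i) 'C(coincidences D i i', t)))%N.
  by apply: eq_bigr => i _; rewrite (bigD1 i) //= coincidences_diag.
by rewrite big_split /= sum_nat_const card_ord.
Qed.

Lemma coincidence_moment0 (F : finFieldType) (N m : nat) (D : 'M[F]_(N, m)) :
  coincidence_moment D 0 = (N * N)%N.
Proof.
rewrite /coincidence_moment.
under eq_bigr do [under eq_bigr do rewrite bin0; rewrite sum1_card card_ord].
by rewrite sum_nat_const card_ord.
Qed.

Lemma coincidence_moment1_balanced (F : finFieldType) (N m : nat)
    (D : 'M[F]_(N, m)) :
  balanced D -> (coincidence_moment D 1 * #|F| = m * (N * N))%N.
Proof.
move=> bal; rewrite /coincidence_moment.
transitivity ((\sum_(k < m) \sum_i #|[set i' | D i' k == D i k]|) * #|F|)%N.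
  congr (_ * _)%N; rewrite [RHS]exchange_big /=; apply: eq_bigr => i _.
  under [LHS]eq_bigr do rewrite bin1 /coincidences -sum1dep_card big_mkcond /=.
  rewrite exchange_big /=; apply: eq_bigr => k _.
  by rewrite -sum1dep_card [RHS]big_mkcond; under eq_bigr do rewrite eq_sym.
rewrite big_distrl /=; under eq_bigr do rewrite big_distrl /=.
under eq_bigr do [under eq_bigr do rewrite bal; rewrite sum_nat_const card_ord].
by rewrite sum_nat_const card_ord.
Qed.

(** Among balanced designs of the same size, the mean number of coincidences
    is fixed, so a convex function of that number has the least possible sum
    when at most two consecutive values occur. *)
Lemma coincidence_moment_min (F : finFieldType) (N m q : nat)
    (D D' : 'M[F]_(N, m)) :
  balanced D -> balanced D' ->
  (forall i i', i' != i ->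
     coincidences D i i' = q \/ coincidences D i i' = q.+1) ->
  forall t, (coincidence_moment D t <= coincidence_moment D' t)%N.
Proof.
move=> bal bal' near_q [|t]; first by rewrite !coincidence_moment0.
have F_gt0 : (0 < #|F|)%N by apply/card_gt0P; exists 0.
pose off (E : 'M[F]_(N, m)) u :=
  (\sum_i \sum_(i' | i' != i) 'C(coincidences E i i', u))%N.
have off1 : off D 1 = off D' 1.
  apply: (@addnI (N * 'C(m, 1))); rewrite -!coincidence_moment_offdiag.
  by apply/eqP; rewrite -(eqn_pmul2r F_gt0) !coincidence_moment1_balanced.
rewrite !coincidence_moment_offdiag leq_add2l -/(off D _) -/(off D' _).
pose line (E : 'M[F]_(N, m)) := (\sum_i \sum_(i' | i' != i)
   ('C(q, t.+1) + coincidences E i i' * 'C(q, t)))%N.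
pose chord (E : 'M[F]_(N, m)) := (\sum_i \sum_(i' | i' != i)
   ('C(coincidences E i i', t.+1) + q * 'C(q, t)))%N.
pose cst a : nat := (\sum_(i < N) \sum_(i' < N | i' != i) a)%N.
have lineE E : line E = (cst 'C(q, t.+1) + off E 1%N * 'C(q, t))%N.
  rewrite /line /cst /off big_distrl -big_split /=; apply: eq_bigr => i _.
  rewrite big_distrl -big_split /=; apply: eq_bigr => i' _.
  by rewrite bin1.
have chordE E : chord E = (off E t.+1 + cst (q * 'C(q, t)))%N.
  rewrite /chord /cst /off -big_split /=; apply: eq_bigr => i _.
  by rewrite -big_split.
rewrite -(leq_add2r (cst (q * 'C(q, t)))%N) -!chordE.
have -> : chord D = line D.
  apply: eq_bigr => i _; apply: eq_bigr => i' /(near_q i) [] ->.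
    by [].
  by rewrite binS mulSn; lia.
rewrite lineE off1 -lineE.
by apply: leq_sum => i _; apply: leq_sum => i' _; apply: binomial_chord.
Qed.

Lemma GMA_optimal_coincidences (F : finFieldType) (C : numClosedFieldType)
    (c : 'I_(#|F|.-1) -> F -> C) (N m q : nat) (D : 'M[F]_(N, m)) :
  orthonormal_contrasts c -> balanced D ->
  (forall i i', i' != i ->
     coincidences D i i' = q \/ coincidences D i i' = q.+1) ->
  GMA_optimal c D.
Proof.
move=> hc bal near_q [D' [r [[_ _ bal'] /andP[r_gt0 _] eqA ltA]]].
have [N0|N_gt0] := posnP N.
  have V0 : N%:R ^- 2 = 0 :> C by rewrite N0 expr0n invr0.
  by move: ltA; rewrite !gwp_coincidence_moment // V0 !mul0r ltxx.
have F_neq0 : #|F|%:R != 0 :> C.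
  by rewrite pnatr_eq0 -lt0n; apply/card_gt0P; exists 0.
have V_gt0 : 0 < N%:R ^- 2 :> C by rewrite invr_gt0 exprn_gt0 // ltr0n.
have eqB t : (t < r)%N -> coincidence_moment D' t = coincidence_moment D t.
  elim/ltn_ind: t => t IHt lt_tr.
  have [->|t_gt0] := posnP t; first by rewrite !coincidence_moment0.
  have := eqA t; rewrite t_gt0 lt_tr => /(_ isT).
  rewrite !gwp_coincidence_moment //; move/(mulfI (lt0r_neq0 V_gt0)).
  rewrite !big_ord_recr /= => eqt.
  have := eqt; rewrite (eq_bigr (fun j : 'I_t => #|F|%:R ^+ j *
      (-1) ^+ (t - j) * 'C(m - j, t - j)%:R * (coincidence_moment D j)%:R)).
    rewrite subnn bin0 expr0 !mulr1 => /addrI /mulfI.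
    by rewrite expf_eq0 (negPf F_neq0) andbF => /(_ isT) /eqP; rewrite eqr_nat => /eqP.
  by move=> j _; rewrite IHt // (ltn_trans _ lt_tr).
move: ltA; rewrite !gwp_coincidence_moment // ltr_pM2l // !big_ord_recr /=.
rewrite (eq_bigr (fun j : 'I_r => #|F|%:R ^+ j *
      (-1) ^+ (r - j) * 'C(m - j, r - j)%:R * (coincidence_moment D j)%:R)).
  rewrite ltrD2l subnn bin0 expr0 !mulr1 ltr_pM2l ?exprn_gt0 ?lt0r ?F_neq0 ?ler0n //.
  rewrite ltr_nat ltnNge => /negP; apply.
  exact: (coincidence_moment_min bal bal' near_q).
by move=> j _; rewrite eqB.
Qed.

(** * Projected values of A_2 *)

Lemma sum_card2 (R : comPzRingType) (m : nat) (f : 'I_m -> R) :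
  \sum_(K : {set 'I_m} | #|K| == 2) \prod_(k in K) f k =
  \sum_(p : 'I_m * 'I_m | (p.1 < p.2)%N) f p.1 * f p.2.
Proof.
pose h (p : 'I_m * 'I_m) := [set p.1; p.2].
pose A := [pred p : 'I_m * 'I_m | (p.1 < p.2)%N].
have h_inj : {in A &, injective h}.
  move=> [a b] [a' b']; rewrite !inE /= => lt_ab lt_ab' /setP eq_h.
  have := eq_h a; have := eq_h b; have := eq_h a'; have := eq_h b'.
  rewrite !inE /= !eqxx ?orbT -!val_eqE /= => e1 e2 e3 e4.
  by congr (_, _); apply: val_inj => /=; lia.
transitivity (\sum_(K in [set h p | p in A]) \prod_(k in K) f k).
  apply: eq_bigl => K; apply/idP/imsetP => [/cards2P[a [b [ne_ab ->]]]|[p]].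
    have [lt_ab|lt_ba|/val_inj eq_ab] := ltngtP a b.
    - by exists (a, b).
    - by exists (b, a); rewrite // /h setUC.
    - by rewrite eq_ab eqxx in ne_ab.
  by rewrite !inE => lt_p ->; rewrite cards2 neq_ltn lt_p.
rewrite big_imset //=; apply: eq_bigr => p lt_p.
have ne_p : p.1 \notin [set p.2].
  by rewrite inE; apply: contraTneq lt_p => eq_p; rewrite inE eq_p ltnn.
by rewrite /h big_setU1 // big_set1.
Qed.

Lemma projected_A2_kernel (F : finFieldType) (C : numClosedFieldType)
    (c : 'I_(#|F|.-1) -> F -> C) (N m : nat) (D : 'M[F]_(N, m)) (u v : 'I_m) :
  orthonormal_contrasts c ->
  projected_A2 c D u v = N%:R ^- 2 * \sum_i \sum_i'
    (#|F|%:R * (D i u == D i' u)%:R - 1) * (#|F|%:R * (D i v == D i' v)%:R - 1).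
Proof.
move=> hc; rewrite /projected_A2 gwp_kernel //; congr (_ * _).
apply: eq_bigr => i _; apply: eq_bigr => i' _.
rewrite (big_pred1 setT) => [|K].
  by rewrite big_mkcond !big_ord_recl big_ord0 /= !inE mulr1 !mxE.
rewrite /= eqEcard subsetT cardsT card_ord eqn_leq.
by rewrite -[X in (_ <= X)%N]card_ord max_card.
Qed.

Lemma gwp2_projected (F : finFieldType) (C : numClosedFieldType)
    (c : 'I_(#|F|.-1) -> F -> C) (N m : nat) (D : 'M[F]_(N, m)) :
  orthonormal_contrasts c ->
  gwp c 2 D = \sum_(p : 'I_m * 'I_m | (p.1 < p.2)%N) projected_A2 c D p.1 p.2.
Proof.
move=> hc; rewrite gwp_kernel //.
under [RHS]eq_bigr do rewrite projected_A2_kernel //.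
rewrite -mulr_sumr; congr (_ * _); rewrite [RHS]exchange_big /=.
apply: eq_bigr => i _; rewrite [RHS]exchange_big /=; apply: eq_bigr => i' _.
exact: sum_card2.
Qed.

Lemma sum_eq_balanced (F : finFieldType) (R : comPzRingType) (N m : nat)
    (D : 'M[F]_(N, m)) (u : 'I_m) :
  balanced D ->
  #|F|%:R * \sum_i \sum_i' (D i u == D i' u)%:R = N%:R ^+ 2 :> R.
Proof.
move=> bal; rewrite mulr_sumr.
rewrite (eq_bigr (fun=> N%:R)) => [|i _].
  by rewrite sumr_const card_ord expr2 mulr_natr.
rewrite -natr_sum -natrM; congr (_%:R); rewrite -[RHS](bal u (D i u)) mulnC.
rewrite -sum1dep_card [in RHS]big_mkcond.
by under eq_bigr do rewrite eq_sym.
Qed.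

(** The inner sum is the sum of the squares of the level counts, here taken
    over the rows rather than over the level combinations. *)
Lemma projected_A2_level_count (F : finFieldType) (C : numClosedFieldType)
    (c : 'I_(#|F|.-1) -> F -> C) (N m : nat) (D : 'M[F]_(N, m)) (u v : 'I_m) :
  orthonormal_contrasts c -> balanced D -> (0 < N)%N ->
  projected_A2 c D u v =
  #|F|%:R ^+ 2 * (\sum_i level_count D u v (D i u, D i v))%:R / N%:R ^+ 2 - 1.
Proof.
move=> hc bal N_gt0; rewrite projected_A2_kernel // mulrC.
have N_neq0 : N%:R != 0 :> C by rewrite pnatr_eq0 -lt0n.
apply: (canLR (mulfK _)); first by rewrite expf_neq0.
rewrite mulrBl mul1r divfK ?expf_neq0 //.
transitivity (\sum_i \sum_i' (#|F|%:R ^+ 2 *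
     ((D i' u, D i' v) == (D i u, D i v))%:R - #|F|%:R * (D i u == D i' u)%:R -
     #|F|%:R * (D i v == D i' v)%:R + 1) : C).
  apply: eq_bigr => i _; apply: eq_bigr => i' _.
  rewrite xpair_eqE [D i u == _]eq_sym [D i v == _]eq_sym -mulnb natrM; ring.
under [LHS]eq_bigr do rewrite big_split sumrB sumrB /= -!mulr_sumr.
rewrite big_split sumrB sumrB /= -!mulr_sumr !sum_eq_balanced //.
rewrite !sumr_const card_ord -[1 *+ N *+ N]mulr_natr -expr2.
rewrite -addrA addNr addr0 natr_sum; congr (_ * _ - _).
apply: eq_bigr => i _.
by rewrite -natr_sum /level_count -sum1dep_card [in RHS]big_mkcond.
Qed.

Lemma sum_level_count (F : finFieldType) (N m : nat) (D : 'M[F]_(N, m))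
    (u v : 'I_m) :
  (\sum_z level_count D u v z = N)%N.
Proof.
rewrite -[RHS]card_ord -sum1_card.
rewrite [RHS](partition_big (fun i => (D i u, D i v)) xpredT) //=.
by apply: eq_bigr => z _; rewrite sum1dep_card.
Qed.

(** * Linear forms and points of projective space *)

Lemma linear_formE (F : finFieldType) (n : nat) (c x : 'rV[F]_n) :
  linear_form c x = (x *m c^T) 0 0.
Proof. by rewrite /linear_form mxE; apply: eq_bigr => i _; rewrite mxE mulrC. Qed.

Lemma linear_formC (F : finFieldType) (n : nat) (c x : 'rV[F]_n) :
  linear_form c x = linear_form x c.
Proof. by apply: eq_bigr => i _; rewrite mulrC. Qed.

Lemma linear_formBr (F : finFieldType) (n : nat) (c x y : 'rV[F]_n) :
  linear_form c (x - y) = linear_form c x - linear_form c y.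
Proof. by rewrite !linear_formE mulmxBl !mxE. Qed.

Lemma linear_formDl (F : finFieldType) (n : nat) (c d x : 'rV[F]_n) :
  linear_form (c + d) x = linear_form c x + linear_form d x.
Proof. by rewrite !linear_formE linearD mulmxDr mxE. Qed.

Lemma linear_formZl (F : finFieldType) (n : nat) (a : F) (c x : 'rV[F]_n) :
  linear_form (a *: c) x = a * linear_form c x.
Proof. by rewrite !linear_formE linearZ -scalemxAr mxE. Qed.

Lemma mulmx_tr_form (F : finFieldType) (n : nat) (c x : 'rV[F]_n) (y : F) :
  (x *m c^T == y%:M) = (linear_form c x == y).
Proof.
rewrite linear_formE [x *m c^T]mx11_scalar !mxE eqxx mulr1n.
by apply/eqP/eqP => [/matrixP/(_ 0 0)|->]; rewrite // !mxE eqxx !mulr1n.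
Qed.

Lemma row_free_col_mx (F : fieldType) (r n : nat) (A : 'M[F]_(r, n))
    (v : 'rV[F]_n) :
  row_free A -> ~~ (v <= A)%MS -> row_free (col_mx A v).
Proof.
move=> freeA nvA; apply: inj_row_free => w.
rewrite -[w]hsubmxK mul_row_col [rsubmx w]mx11_scalar mul_scalar_mx.
set a := rsubmx w 0 0 => eq0.
have a0 : a = 0.
  apply/eqP; apply: contraNT nvA => a_neq0; apply/submxP.
  exists (- a^-1 *: lsubmx w); rewrite -scalemxAl -(addr0_eq (etrans (addrC _ _) eq0)).
  by rewrite scaleNr scalerN opprK scalerA mulVf // scale1r.
move: eq0; rewrite a0 scale0r addr0 => /eqP.
by rewrite mulmx_free_eq0 // => /eqP ->; rewrite raddf0 row_mx0.
Qed.

(** The fibres of a surjective linear map all have the same cardinal. *)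
Lemma card_fibre (F : finFieldType) (r n : nat) (A : 'M[F]_(r, n))
    (y : 'rV[F]_r) :
  row_free A ->
  (#|[set x : 'rV[F]_n | x *m A^T == y]| * #|F| ^ r = #|F| ^ n)%N.
Proof.
case/row_freeP => B AB.
have fibre0 z : #|[set x : 'rV[F]_n | x *m A^T == z]| =
                #|[set x : 'rV[F]_n | x *m A^T == 0]|.
  rewrite -[RHS](card_imset _ (addrI (z *m B^T))); apply: eq_card => x.
  apply/idP/imsetP => [|[x']]; rewrite !inE.
    move=> /eqP xz; exists (x - z *m B^T); last by rewrite addrC subrK.
    by rewrite inE mulmxBl -mulmxA -trmx_mul AB trmx1 mulmx1 xz subrr.
  by move=> /eqP x'0 ->; rewrite mulmxDl -mulmxA -trmx_mul AB trmx1 mulmx1 x'0 addr0.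
have := card_mx F 1 n; rewrite mul1n => <-.
rewrite -[RHS]sum1_card (partition_big (fun x => x *m A^T) xpredT) //=.
under eq_bigr do rewrite sum1dep_card fibre0.
by rewrite sum_nat_const card_mx mul1n fibre0 mulnC.
Qed.

Lemma row_free_rV (F : fieldType) (n : nat) (v : 'rV[F]_n) :
  v != 0 -> row_free v.
Proof. by rewrite /row_free rank_rV => ->. Qed.

Lemma sub_col_mxP (F : fieldType) (n : nat) (u v w : 'rV[F]_n) :
  reflect (exists a b, w = a *: u + b *: v) (w <= col_mx u v)%MS.
Proof.
apply: (iffP submxP) => [[x ->]|[a [b ->]]].
  exists (lsubmx x 0 0), (rsubmx x 0 0); rewrite -[x in LHS]hsubmxK mul_row_col.
  by rewrite -!mul_scalar_mx -!mx11_scalar.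
by exists (row_mx a%:M b%:M); rewrite mul_row_col !mul_scalar_mx.
Qed.

Lemma H_forms_neq0 (F : finFieldType) (n : nat) (h : 'rV[F]_n) :
  h \in H_forms F n -> h != 0.
Proof.
rewrite inE => /existsP[i /andP[/eqP hi _]].
by apply: contra_eq_neq hi => ->; rewrite mxE eq_sym oner_neq0.
Qed.

(** Distinct elements of [H_forms] are not proportional. *)
Lemma H_forms_scale (F : finFieldType) (n : nat) (h h' : 'rV[F]_n) (a : F) :
  h \in H_forms F n -> h' \in H_forms F n -> h' = a *: h -> h' = h.
Proof.
rewrite !inE => /existsP[i /andP[/eqP hi /forallP hgt]].
move=> /existsP[i' /andP[/eqP hi' /forallP hgt']] eq_h'.
have a_neq0 : a != 0.
  by apply: contra_eq_neq hi' => a0; rewrite eq_h' a0 scale0r mxE eq_sym oner_neq0.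
have [lt_ii'|lt_i'i|/val_inj eq_ii'] := ltngtP i i'.
- have := hgt i'; rewrite lt_ii' => /eqP h0.
  by move: hi'; rewrite eq_h' mxE h0 mulr0 => /eqP; rewrite eq_sym oner_eq0.
- have := hgt' i; rewrite lt_i'i /= eq_h' mxE hi mulr1 => /eqP a0.
  by rewrite a0 eqxx in a_neq0.
by move: hi'; rewrite -eq_ii' eq_h' mxE hi mulr1 => ->; rewrite scale1r.
Qed.

Lemma H_forms_normalize (F : finFieldType) (n : nat) (v : 'rV[F]_n) :
  v != 0 -> exists2 a, a != 0 & a *: v \in H_forms F n.
Proof.
move=> /rV0Pn[i0 vi0].
case: (@arg_maxnP _ i0 (fun i => v 0 i != 0) val vi0) => i vi max_i.
exists (v 0 i)^-1; first by rewrite invr_eq0.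
rewrite inE; apply/existsP; exists i; rewrite mxE mulVf // eqxx /=.
apply/forallP => j; apply/implyP => lt_ij; rewrite mxE mulf_eq0; apply/orP; right.
by apply: contraTT lt_ij => vj; rewrite -leqNgt; apply: max_i.
Qed.

(** [H_forms] meets each punctured line once, so it picks one element in
    [#|F| - 1] in any set of nonzero vectors stable under scaling. *)
Lemma card_cone_H_forms (F : finFieldType) (n : nat) (V : {set 'rV[F]_n}) :
  0 \notin V -> (forall a v, a != 0 -> v \in V -> a *: v \in V) ->
  #|V| = (#|F|.-1 * #|V :&: H_forms F n|)%N.
Proof.
move=> V0 VZ; have -> : #|F|.-1 = #|[set~ (0 : F)]| by rewrite cardsC1.
rewrite -cardsX.
have inj : {in setX [set~ 0] (V :&: H_forms F n) &,
            injective (fun p : F * 'rV[F]_n => p.1 *: p.2)}.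
  move=> [a h] [a' h']; rewrite !in_setX !in_setC1 !in_setI /=.
  move=> /andP[a0 /andP[_ hH]] /andP[a'0 /andP[_ hH']] eq_ah.
  have eq_h : h' = h.
    apply: (@H_forms_scale _ _ _ _ (a'^-1 * a)) => //.
    by rewrite -scalerA eq_ah scalerA mulVf // scale1r.
  rewrite eq_h in eq_ah *; congr (_, _); apply/eqP; rewrite -subr_eq0.
  have h0 : h != 0 by apply: H_forms_neq0.
  have := subrr (a *: h); rewrite {2}eq_ah -scalerBl => /eqP.
  by rewrite scaler_eq0 (negPf h0) orbF.
rewrite -(card_in_imset inj); apply: eq_card => v; apply/idP/imsetP.
  move=> vV; have v0 : v != 0 by apply: contraNneq V0 => <-.
  have [a a0 avH] := H_forms_normalize v0.
  exists (a^-1, a *: v); last by rewrite scalerA mulVf // scale1r.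
  by rewrite in_setX in_setC1 invr_eq0 a0 in_setI avH VZ.
case=> [[a h]]; rewrite in_setX in_setC1 in_setI /= => /andP[a0 /andP[hV _]] ->.
exact: VZ.
Qed.

Lemma card_H_forms (F : finFieldType) (n : nat) :
  (#|F|.-1 * #|H_forms F n| = (#|F| ^ n).-1)%N.
Proof.
have <- : [set~ 0] :&: H_forms F n = H_forms F n.
  apply/setIidPr/subsetP => h /H_forms_neq0.
  by rewrite in_setC1.
rewrite -card_cone_H_forms ?in_setC1 ?eqxx // => [|a v a0].
  by rewrite cardsC1 card_mx mul1n.
by rewrite !in_setC1 scaler_eq0 (negPf a0).
Qed.

(** The hyperplane of the forms vanishing at [d]. *)
Lemma card_H_forms_root (F : finFieldType) (n : nat) (d : 'rV[F]_n) :
  d != 0 ->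
  (#|F|.-1 * #|[set h in H_forms F n | linear_form h d == 0%R]| =
   (#|F| ^ n.-1).-1)%N.
Proof.
case: n d => [|n] d d0; first by rewrite thinmx0 eqxx in d0.
have F_gt0 : (0 < #|F|)%N by apply/card_gt0P; exists 0.
pose V := [set h : 'rV[F]_n.+1 | linear_form h d == 0] :\ 0.
have -> : [set h in H_forms F n.+1 | linear_form h d == 0] =
          V :&: H_forms F n.+1.
  apply/setP => h; rewrite [LHS]inE in_setI in_setD1 andbC.
  have [hH|//] := boolP (h \in H_forms _ _); last by rewrite !andbF.
  by rewrite (H_forms_neq0 hH) inE.
rewrite -card_cone_H_forms ?in_setD1 ?eqxx // => [|a v a0]; last first.
  rewrite !in_setD1 !inE scaler_eq0 (negPf a0) linear_formZl => /andP[-> /eqP ->].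
  by rewrite mulr0 eqxx.
have := cardsD1 0 [set h : 'rV[F]_n.+1 | linear_form h d == 0].
rewrite inE linear_formE trmx0 mulmx0 mxE eqxx /= add1n -/V.
have := card_fibre 0 (row_free_rV d0); rewrite expn1 expnSr => /eqP.
rewrite eqn_pmul2r // => /eqP <-.
rewrite (_ : [set x | x *m d^T == 0] = [set h | linear_form h d == 0]).
  by move=> ->.
by apply/setP => x; rewrite !inE linear_formC -mulmx_tr_form raddf0.
Qed.

(** A projective line has [#|F| + 1] points. *)
Lemma card_H_forms_line (F : finFieldType) (n : nat) (u v : 'rV[F]_n) :
  (2 < #|F|)%N -> row_free (col_mx u v) ->
  #|[set h in H_forms F n | (h <= col_mx u v)%MS]| = #|F|.+1.
Proof.
move=> F_gt2 free_uv.
pose V := [set h : 'rV[F]_n | (h <= col_mx u v)%MS] :\ 0.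
have -> : [set h in H_forms F n | (h <= col_mx u v)%MS] = V :&: H_forms F n.
  apply/setP => h; rewrite [LHS]inE in_setI in_setD1 andbC.
  have [hH|//] := boolP (h \in H_forms _ _); last by rewrite !andbF.
  by rewrite (H_forms_neq0 hH) inE.
have V0 : 0 \notin V by rewrite in_setD1 eqxx.
have VZ a w : a != 0 -> w \in V -> a *: w \in V.
  move=> a0; rewrite !in_setD1 !inE scaler_eq0 (negPf a0) => /andP[-> wV].
  by rewrite scalemx_sub.
have := card_cone_H_forms V0 VZ.
have := cardsD1 0 [set h : 'rV[F]_n | (h <= col_mx u v)%MS].
rewrite inE sub0mx -/V.
have -> : [set h : 'rV[F]_n | (h <= col_mx u v)%MS] =
          [set w *m col_mx u v | w : 'rV[F]_2].
  apply/setP => h; rewrite inE; apply/submxP/imsetP => [[w ->]|[w _ ->]].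
    by exists w.
  by exists w.
rewrite card_imset; last exact: row_free_inj.
rewrite card_mx mul1n => card_V eq_V; apply/eqP.
have F1 : (0 < #|F|.-1)%N by rewrite -subn1 subn_gt0 ltnW.
rewrite -(eqn_pmul2l F1) -eq_V; apply/eqP.
have sq : (#|F| * #|F| = #|V|.+1)%N by rewrite mulnn.
by apply: succn_inj; rewrite -sq; case: #|F| F1 => // f _ /=; ring.
Qed.

Lemma card_enum_val (T : finType) (A : {set T}) (P : pred T) :
  #|[set i : 'I_#|A| | P (enum_val i)]| = #|[set x in A | P x]|.
Proof.
rewrite -(card_imset _ enum_val_inj); apply: eq_card => x.
apply/imsetP/idP => [[i]|]; rewrite !inE; first by move=> Pi ->; rewrite enum_valP.
by case/andP=> xA Px; exists (enum_rank_in xA x); rewrite ?inE enum_rankK_in.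
Qed.

Lemma row_free_H_forms (F : finFieldType) (n : nat) (u v : 'rV[F]_n) :
  u \in H_forms F n -> v \in H_forms F n -> u != v -> row_free (col_mx u v).
Proof.
move=> uH vH ne_uv; apply: row_free_col_mx; first exact/row_free_rV/H_forms_neq0.
apply: contraNN ne_uv => /sub_rVP[a eq_v].
by rewrite (H_forms_scale uH vH eq_v).
Qed.

(** If [v] lies on the line through [u] and [w], then [w] lies on the line
    through [u] and [v]. *)
Lemma H_forms_collinear (F : finFieldType) (n : nat) (u v w : 'rV[F]_n) :
  u \in H_forms F n -> v \in H_forms F n -> u != v ->
  (v <= col_mx u w)%MS -> (w <= col_mx u v)%MS.
Proof.
move=> uH vH ne_uv /sub_col_mxP[x [y eq_v]]; apply/sub_col_mxP.
have y0 : y != 0.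
  apply: contraNneq ne_uv => y0; rewrite y0 scale0r addr0 in eq_v.
  by rewrite (H_forms_scale uH vH eq_v).
exists (- (y^-1 * x)), y^-1.
by rewrite eq_v scalerDr !scalerA mulVf // scale1r addrA -scalerDl addNr scale0r add0r.
Qed.

(** Adding the constraint that the branching form takes its value in [S] to
    [r] linear equations independent of it. *)
Lemma card_fraction_fibre (F : finFieldType) (r n : nat) (A : 'M[F]_(r, n))
    (b : 'rV[F]_n) (S : {set F}) (y : 'rV[F]_r) :
  row_free (col_mx A b) ->
  (#|[set x in fraction_rows b S | x *m A^T == y]| * #|F| ^ r.+1 =
   #|S| * #|F| ^ n)%N.
Proof.
move=> freeAb.
rewrite -sum1_card (partition_big (linear_form b) (mem S)) /=; last first.
  by move=> x; rewrite !inE => /andP[].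
rewrite big_distrl -sum_nat_const /=; apply: eq_bigr => z zS.
rewrite -(card_fibre (row_mx y z%:M) freeAb) -[r.+1]addn1 sum1dep_card; congr (_ * _)%N.
apply: eq_card => x; rewrite !inE tr_col_mx mul_mx_row.
apply/andP/eqP => [[/andP[_ /eqP ->]]|/eq_row_mx[-> /eqP]].
  by rewrite -mulmx_tr_form => /eqP ->.
by rewrite mulmx_tr_form => /eqP ->; rewrite zS eqxx.
Qed.

Lemma card_fraction_rows (F : finFieldType) (n : nat) (b : 'rV[F]_n)
    (S : {set F}) :
  b != 0 -> (#|fraction_rows b S| * #|F| = #|S| * #|F| ^ n)%N.
Proof.
move=> b0; pose A : 'M[F]_(0, n) := 0.
have freeAb : row_free (col_mx A b).
  apply: row_free_col_mx; last first.
    by apply: contraNN b0 => /submxP[w ->]; rewrite [w]thinmx0 mul0mx.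
  by rewrite /row_free -leqn0 rank_leq_row.
rewrite -(card_fraction_fibre S 0 freeAb) expn1; congr (_ * _)%N.
by apply: eq_card => x; rewrite !inE [x *m _]thinmx0 eqxx andbT.
Qed.

(** * The juxtaposed fractions *)

Section Juxtaposition.

Variables (F : finFieldType) (n : nat) (b : 'rV[F]_n) (S : {set F}).
Hypothesis bH : b \in H_forms F n.

Local Notation D := (juxtaposition b S).
Local Notation N := #|fraction_rows b S|.
Local Notation col u := (enum_val u : 'rV[F]_n).

Lemma juxtaposition_colP (u : 'I_#|H_forms F n :\ b|) :
  col u \in H_forms F n /\ col u != b.
Proof. by have := enum_valP u; rewrite in_setD1 => /andP[]. Qed.

Lemma juxtaposition_balanced : balanced D.
Proof.
move=> u y; have F_gt0 : (0 < #|F|)%N by apply/card_gt0P; exists 0.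
have [uH ne_ub] := juxtaposition_colP u.
apply/eqP; rewrite -(eqn_pmul2r F_gt0) card_fraction_rows ?H_forms_neq0 //.
rewrite -(card_fraction_fibre S y%:M (row_free_H_forms uH bH ne_ub)).
rewrite -mulnA mulnn; apply/eqP; congr (_ * _)%N.
rewrite -(card_enum_val _ (fun x => x *m (col u)^T == y%:M)).
by apply: eq_card => i; rewrite !inE mxE mulmx_tr_form.
Qed.

Lemma juxtaposition_level_count u v z :
  level_count D u v z = #|[set x in fraction_rows b S |
    x *m (col_mx (col u) (col v))^T == row_mx z.1%:M z.2%:M]|.
Proof.
rewrite -(card_enum_val _ (fun x =>
  x *m (col_mx (col u) (col v))^T == row_mx z.1%:M z.2%:M)).
apply: eq_card => i; rewrite !inE !mxE tr_col_mx mul_mx_row -pair_eqE /=.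
rewrite -!mulmx_tr_form.
apply/andP/eqP => [[/eqP -> /eqP ->]|/eq_row_mx[-> ->]] //.
Qed.

(** The two columns and the branching column are collinear as points. *)
Definition collinear_columns (u v : 'I_#|H_forms F n :\ b|) : bool :=
  (b <= col_mx (col u) (col v))%MS.

Lemma level_count_noncollinear u v z :
  u != v -> ~~ collinear_columns u v ->
  (level_count D u v z * #|F| ^ 2 = N)%N.
Proof.
move=> ne_uv nb; have F_gt0 : (0 < #|F|)%N by apply/card_gt0P; exists 0.
have [[uH _] [vH _]] := (juxtaposition_colP u, juxtaposition_colP v).
have free_uv : row_free (col_mx (col u) (col v)).
  by apply: row_free_H_forms; rewrite // (inj_eq enum_val_inj).
apply/eqP; rewrite -(eqn_pmul2r F_gt0) card_fraction_rows ?H_forms_neq0 //.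
rewrite -(card_fraction_fibre S (row_mx z.1%:M z.2%:M) (row_free_col_mx free_uv nb)).
by rewrite juxtaposition_level_count -mulnA -expnSr.
Qed.

Lemma collinear_columnsP u v :
  u != v -> collinear_columns u v ->
  exists x y, [/\ x != 0, b = x *: col u + y *: col v &
    forall z, (level_count D u v z * #|F| ^ 2 =
               ((x * z.1 + y * z.2)%R \in S) * #|F| ^ n)%N].
Proof.
move=> ne_uv /sub_col_mxP[x [y eq_b]]; exists x, y.
have [[uH _] [vH ne_vb]] := (juxtaposition_colP u, juxtaposition_colP v).
have free_uv : row_free (col_mx (col u) (col v)).
  by apply: row_free_H_forms; rewrite // (inj_eq enum_val_inj).
split=> // [|z].
  apply: contraNneq ne_vb => x0; rewrite x0 scale0r add0r in eq_b.
  exact/eqP/esym/(H_forms_scale vH bH eq_b).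
rewrite juxtaposition_level_count -(card_fibre (row_mx z.1%:M z.2%:M) free_uv).
rewrite mulnA; congr (_ * _)%N.
have fibreP w : w *m (col_mx (col u) (col v))^T = row_mx z.1%:M z.2%:M ->
    linear_form b w = x * z.1 + y * z.2.
  rewrite tr_col_mx mul_mx_row => /eq_row_mx[/eqP wu /eqP wv].
  move: wu wv; rewrite !mulmx_tr_form => /eqP wu /eqP wv.
  by rewrite eq_b linear_formDl !linear_formZl wu wv.
case: (boolP (_ \in S)) => xyS; rewrite ?mul1n ?mul0n.
  apply: eq_card => w; rewrite !inE; apply: andb_idl => /eqP/fibreP ->.
  exact: xyS.
apply/eqP; rewrite cards_eq0; apply/eqP/setP => w; rewrite !inE.
by apply/negP => /andP[wS /eqP/fibreP eq_w]; rewrite -eq_w wS in xyS.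
Qed.

Hypothesis S_gt0 : (0 < #|S|)%N.
Hypothesis S_lt : (#|S| < #|F|)%N.

Lemma orthogonal_columns_collinear u v :
  u != v -> orthogonal_columns D u v = ~~ collinear_columns u v.
Proof.
move=> ne_uv; have F_gt0 : (0 < #|F|)%N by apply/card_gt0P; exists 0.
have F2_gt0 : (0 < #|F| ^ 2)%N by rewrite expn_gt0 F_gt0.
apply/idP/idP => [/forallP orth|nb].
  apply/negP => /(collinear_columnsP ne_uv)[x [y [x0 _ LC]]].
  have [w wS] := card_gt0P S_gt0.
  have [w' w'S] : exists w', w' \notin S.
    apply/existsP; rewrite -negb_forall; apply/negP => /forallP allS.
    by move: S_lt; rewrite (eq_card (B := F)) ?ltnn // => w'; rewrite allS.
  have /forallP/(_ (w' / x, 0))/eqP eqLC := orth (w / x, 0).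
  have := LC (w / x, 0); rewrite eqLC LC /= !mulr0 !addr0 ![x * _]mulrC !divfK //.
  rewrite wS (negPf w'S) mul0n mul1n => /eqP.
  by rewrite eq_sym expn_eq0 -leqn0 leqNgt F_gt0.
apply/forallP => z; apply/forallP => z'.
by rewrite -(eqn_pmul2r F2_gt0) !level_count_noncollinear.
Qed.

Lemma fraction_rows_gt0 : (0 < N)%N.
Proof.
have F_gt0 : (0 < #|F|)%N by apply/card_gt0P; exists 0.
rewrite -(ltn_pmul2r F_gt0) mul0n card_fraction_rows ?H_forms_neq0 //.
by rewrite muln_gt0 S_gt0 expn_gt0 F_gt0.
Qed.

Lemma projected_A2_noncollinear (C : numClosedFieldType)
    (c : 'I_(#|F|.-1) -> F -> C) u v :
  orthonormal_contrasts c -> u != v -> ~~ collinear_columns u v ->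
  projected_A2 c D u v = 0.
Proof.
move=> hc ne_uv nb.
rewrite projected_A2_level_count //; last 2 first.
- exact: juxtaposition_balanced.
- exact: fraction_rows_gt0.
rewrite -natrX -natrM mulnC big_distrl /=.
under eq_bigr do rewrite level_count_noncollinear //.
rewrite sum_nat_const card_ord mulnn -natrX divff ?subrr // pnatr_eq0 -lt0n.
by rewrite expn_gt0 fraction_rows_gt0.
Qed.

Lemma projected_A2_collinear (C : numClosedFieldType)
    (c : 'I_(#|F|.-1) -> F -> C) u v :
  orthonormal_contrasts c -> u != v -> collinear_columns u v ->
  projected_A2 c D u v = (#|F|%:R - #|S|%:R) / #|S|%:R.
Proof.
move=> hc ne_uv /(collinear_columnsP ne_uv)[x [y [_ eq_b LC]]].
rewrite projected_A2_level_count //; last 2 first.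
- exact: juxtaposition_balanced.
- exact: fraction_rows_gt0.
rewrite -natrX -natrM mulnC big_distrl /=.
rewrite (eq_bigr (fun=> #|F| ^ n)%N) => [|i _]; last first.
  rewrite LC !mxE /= -!linear_formZl -linear_formDl -eq_b.
  by have := enum_valP i; rewrite inE => ->; rewrite mul1n.
rewrite sum_nat_const card_ord natrM.
have F_neq0 : #|F|%:R != 0 :> C.
  by rewrite pnatr_eq0 -lt0n; apply/card_gt0P; exists 0.
have S_neq0 : #|S|%:R != 0 :> C by rewrite pnatr_eq0 -lt0n.
have := congr1 (fun j => j%:R : C) (card_fraction_rows S (H_forms_neq0 bH)).
rewrite !natrM => cardN.
have -> : N%:R = #|S|%:R * (#|F| ^ n)%:R / #|F|%:R :> C by rewrite -cardN mulfK.
have Fn_neq0 : (#|F| ^ n)%:R != 0 :> C by rewrite natrX expf_neq0.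
by field; rewrite S_neq0 F_neq0.
Qed.

(** The points of the line through [u] and [b] other than these two. *)
Lemma card_collinear_columns u :
  (2 < #|F|)%N ->
  #|[set v | (v != u) && collinear_columns u v]| = #|F|.-1.
Proof.
move=> F_gt2; have [uH ne_ub] := juxtaposition_colP u.
pose L := [set h in H_forms F n | (h <= col_mx (col u) b)%MS].
have card_L : #|L| = #|F|.+1.
  exact: (card_H_forms_line F_gt2 (row_free_H_forms uH bH ne_ub)).
have uL : col u \in L.
  by rewrite inE uH /=; apply/sub_col_mxP; exists 1, 0; rewrite scale1r scale0r addr0.
have bL : b \in L :\ col u.
  rewrite in_setD1 eq_sym ne_ub inE bH /=.
  by apply/sub_col_mxP; exists 0, 1; rewrite scale1r scale0r add0r.
transitivity #|L :\ col u :\ b|; last first.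
  have := cardsD1 (col u) L; have := cardsD1 b (L :\ col u).
  by rewrite uL bL card_L => -> [] ->.
rewrite (_ : [set v | _] = [set v | (col v != col u) &&
    (b <= col_mx (col u) (col v))%MS]); last first.
  by apply/setP => v; rewrite !inE (inj_eq enum_val_inj).
rewrite (card_enum_val (H_forms F n :\ b)
  (fun h => (h != col u) && (b <= col_mx (col u) h)%MS)).
apply: eq_card => h; rewrite !in_setD1 [LHS]inE in_setD1 [h \in L]inE.
have [->|ne_hb] //= := eqVneq h b.
have [hH|_] := boolP (h \in H_forms F n); last by rewrite andbF.
have [->|ne_hu] //= := eqVneq h (col u).
by apply/idP/idP; apply: H_forms_collinear => //; rewrite eq_sym.
Qed.

Lemma card_nonorthogonal_pairs :
  (2 < #|F|)%N ->
  (#|[set p : 'I_#|H_forms F n :\ b| * 'I_#|H_forms F n :\ b| |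
      (p.1 < p.2)%N && ~~ orthogonal_columns D p.1 p.2]|.*2 =
   #|H_forms F n :\ b| * #|F|.-1)%N.
Proof.
move=> F_gt2.
pose P := [set p : 'I_#|H_forms F n :\ b| * 'I_#|H_forms F n :\ b| |
      (p.1 < p.2)%N && collinear_columns p.1 p.2].
rewrite (_ : [set p | _] = P); last first.
  apply/setP => p; rewrite !inE; case: ltnP => //= lt_p.
  rewrite orthogonal_columns_collinear ?negbK //.
  by apply: contraTneq lt_p => ->; rewrite ltnn.
have swapK : involutive (fun p : 'I_#|H_forms F n :\ b| * 'I_#|H_forms F n :\ b| =>
  (p.2, p.1)) by case.
(* Ordered pairs of distinct columns: each increasing pair is counted together
   with its transpose. *)
transitivity #|[set p : 'I_#|H_forms F n :\ b| * 'I_#|H_forms F n :\ b| |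
      (p.2 != p.1) && collinear_columns p.1 p.2]|.
  rewrite -addnn -{2}(card_imset P (inv_inj swapK)).
  rewrite -cardsUI [X in (_ + X)%N](_ : _ = 0) ?addn0; last first.
    apply/eqP; rewrite cards_eq0; apply/eqP/setP => p; rewrite !inE.
    apply/negP => /andP[/andP[lt_p _] /imsetP[q]]; rewrite inE => /andP[lt_q _] eq_p.
    by move: lt_p; rewrite eq_p /= ltnNge (ltnW lt_q).
  have colC u v : collinear_columns u v = collinear_columns v u.
    by rewrite /collinear_columns -!addsmxE addsmxC.
  apply: eq_card => -[u v]; rewrite in_setU !inE /= -val_eqE neq_ltn /=.
  have -> : ((u, v) \in [set (p.2, p.1) | p in P]) = (v < u)%N && collinear_columns u v.
    apply/imsetP/idP => [[[u' v']]|lt_vu]; last by exists (v, u); rewrite // inE /= colC.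
    by rewrite inE /= => uvP [-> ->]; rewrite colC.
  by case: ltngtP => //=; rewrite ?orbF.
rewrite -sum1_card (eq_bigl (fun p : 'I__ * 'I__ => xpredT p.1 &&
   ((p.2 != p.1) && collinear_columns p.1 p.2))); last by move=> p; rewrite inE.
rewrite -(pair_big_dep xpredT
   (fun u v => (v != u) && collinear_columns u v) (fun _ _ => 1%N)) /=.
under eq_bigr do rewrite sum1dep_card card_collinear_columns //.
by rewrite sum_nat_const card_ord.
Qed.

Lemma coincidences_juxtaposition i i' :
  let d := (enum_val i - enum_val i' : 'rV[F]_n) in
  (coincidences D i i' + (linear_form b d == 0%R) =
   #|[set h in H_forms F n | linear_form h d == 0%R]|)%N.
Proof.
move=> d.
rewrite [RHS](cardsD1 b) [in RHS]inE bH addnC; congr (_ + _)%N.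
transitivity #|[set u : 'I_#|H_forms F n :\ b| | linear_form (col u) d == 0]|.
  by apply: eq_card => u; rewrite !inE !mxE linear_formBr subr_eq0.
rewrite (card_enum_val _ (fun h => linear_form h d == 0)).
by apply: eq_card => h; rewrite in_setD1 !inE andbA.
Qed.

End Juxtaposition.

Theorem theorem8 (F : finFieldType) (s n k : nat)
    (hF : #|F| = s) (hs : (2 < s)%N) (hn : (2 <= n)%N)
    (hk : (1 <= k < s)%N)
    (b : 'rV[F]_n) (hb : b \in H_forms F n)
    (S : {set F}) (hS : #|S| = k)
    (C : numClosedFieldType) (c : 'I_(#|F|.-1) -> F -> C)
    (hc : orthonormal_contrasts c) :
  let D := juxtaposition b S in
  let m := #|H_forms F n :\ b| in
  is_SSD (k * s ^ n.-1) ((s ^ n - s) %/ (s - 1)) D /\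
  gwp c 2 D = (s%:R ^+ n - s%:R) * (s%:R - k%:R) / (2 * k%:R) /\
  GMA_optimal c D /\
  (forall u v : 'I_m, u != v ->
     projected_A2 c D u v = 0 \/
     projected_A2 c D u v = (s%:R - k%:R) / k%:R) /\
  #|[set p : 'I_m * 'I_m |
      (p.1 < p.2)%N && ~~ orthogonal_columns D p.1 p.2]| = ((s ^ n - s) %/ 2)%N /\
  (forall u v : 'I_m, u != v -> ~~ orthogonal_columns D u v ->
     projected_A2 c D u v = (s%:R - k%:R) / k%:R) /\
  ((1 < k)%N -> forall u v : 'I_m, u != v -> ~ fully_aliased D u v).
Proof.
move=> D m; have /andP[k_gt0 lt_ks] := hk.
have S_gt0 : (0 < #|S|)%N by rewrite hS.
have S_lt : (#|S| < #|F|)%N by rewrite hS hF.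
have F_gt2 : (2 < #|F|)%N by rewrite hF.
have s_gt0 : (0 < s)%N by apply: leq_trans hs.
have s1_gt0 : (0 < s - 1)%N by rewrite subn_gt0 ltnW.
have cardN : #|fraction_rows b S| = (k * s ^ n.-1)%N.
  apply/eqP; rewrite -(eqn_pmul2r s_gt0) -{1}hF card_fraction_rows ?H_forms_neq0 //.
  by rewrite hS hF -mulnA -expnSr prednK // ltnW.
have le_s_sn : (s <= s ^ n)%N by rewrite -{1}[s]expn1 leq_pexp2l // ltnW.
have cardm : (m * (s - 1) = s ^ n - s)%N.
  have := card_H_forms F n; rewrite (cardsD1 b) hb -/m hF; lia.
have orthE u v : u != v -> orthogonal_columns D u v = ~~ collinear_columns u v.
  exact: orthogonal_columns_collinear.
have A2_col u v : u != v -> collinear_columns u v ->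
    projected_A2 c D u v = (s%:R - k%:R) / k%:R.
  by move=> ne_uv col_uv; rewrite projected_A2_collinear // hF hS.
have card2 := card_nonorthogonal_pairs hb S_gt0 S_lt F_gt2.
rewrite -/m -/D hF -subn1 cardm in card2.
split; [|split; [|split; [|split; [|split; [|split]]]]].
- split=> //; last exact: juxtaposition_balanced.
  by rewrite -/m -cardm mulnK.
(* Only the nonorthogonal pairs contribute to the overall [A_2]. *)
- rewrite gwp2_projected // (bigID (fun p => orthogonal_columns D p.1 p.2)) /=.
  rewrite big1 ?add0r => [|p /andP[lt_p]]; last first.
    have ne_p : p.1 != p.2 by apply: contraTneq lt_p => ->; rewrite ltnn.
    by rewrite orthE // => /(projected_A2_noncollinear hb S_gt0 hc ne_p).
  rewrite (eq_bigr (fun=> (s%:R - k%:R) / k%:R)) => [|p /andP[lt_p]]; last first.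
    have ne_p : p.1 != p.2 by apply: contraTneq lt_p => ->; rewrite ltnn.
    by rewrite orthE // negbK; apply: A2_col.
  rewrite sumr_const -[LHS]mulr_natl -natrX -(natrB _ le_s_sn) -card2.
  rewrite -cardsE -muln2 natrM.
  have k_neq0 : k%:R != 0 :> C by rewrite pnatr_eq0 -lt0n.
  have two_neq0 : 2 != 0 :> C by rewrite pnatr_eq0.
  by field; rewrite k_neq0.
- pose Q := (((s ^ n.-1).-1 %/ (s - 1)))%N.
  apply: (GMA_optimal_coincidences (q := Q.-1)) => //.
    exact: juxtaposition_balanced.
  move=> i i' ne_ii'; have := coincidences_juxtaposition hb i i'.
  have d0 : (enum_val i - enum_val i' : 'rV[F]_n) != 0.
    by rewrite subr_eq0 (inj_eq enum_val_inj) eq_sym.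
  have := card_H_forms_root d0; rewrite hF -subn1 => card_root.
  have card_Q : #|[set h in H_forms F n |
      linear_form h (enum_val i - enum_val i') == 0%R]| = Q.
    by rewrite /Q -card_root mulKn.
  have Q_gt0 : (0 < Q)%N.
    rewrite /Q -card_root mulKn // -(ltn_pmul2l s1_gt0) card_root muln0.
    by rewrite -subn1 subn_gt0 -[1%N](expn0 s) ltn_exp2l ?(ltnW hs) //; lia.
  move=> eqc; move: (etrans eqc card_Q).
  by case: eqP => _ /=; rewrite ?addn1 ?addn0 => eqQ;
    [left; rewrite -eqQ | right; rewrite prednK].
- move=> u v ne_uv; case: (boolP (collinear_columns u v)) => col_uv.
    by right; apply: A2_col.
  by left; apply: projected_A2_noncollinear.
- by rewrite -card2 -muln2 mulnK.
- by move=> u v ne_uv; rewrite orthE // negbK; apply: A2_col.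
move=> k_gt1 u v ne_uv [_ aliased].
have [z LCz] : exists z, level_count D u v z != 0%N.
  apply/existsP; rewrite -negb_forall; apply/negP => /forallP LC0.
  have := sum_level_count D u v; rewrite big1 => [/esym/eqP|z _]; last exact/eqP/LC0.
  by rewrite eqn0Ngt fraction_rows_gt0.
(* A level count [N / s] is too large when the columns are not collinear with
   the branching column, and forces [k = 1] when they are. *)
have LCs := aliased z LCz.
have LCs2 : (level_count D u v z * #|F| ^ 2 = k * s ^ n)%N.
  by rewrite -mulnn mulnA LCs card_fraction_rows ?H_forms_neq0 // hS hF.
case: (boolP (collinear_columns u v)) => col_uv.
  have [x [y [_ _ /(_ z)]]] := collinear_columnsP S hb ne_uv col_uv.
  rewrite LCs2 hF => /eqP; rewrite eqn_pmul2r ?expn_gt0 ?s_gt0 // => /eqP.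
  by case: (_ \in S); lia.
have /eqP := etrans (level_count_noncollinear S hb z ne_uv col_uv) (esym LCs).
rewrite eqn_pmul2l ?lt0n // hF -mulnn.
by rewrite -{3}[s]muln1 eqn_pmul2l // => /eqP s1; rewrite s1 in hs.
Qed.
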